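(* For every $n\geq 0$, the number of $DD$-equivalence classes of the set $\mathcal{L}_n$ of Łukasiewicz paths of length $n$ is $g_n$, where $g_0=1$, $g_1=1$, $g_2=1$, $g_3=2$ and $g_n=g_{n-1}+g_{n-2}+g_{n-4}$ for $n\geq 4$.
   Context: A Łukasiewicz path of length $n$ is a sequence of $n$ steps from $\{(1,i): i\geq -1\}$ starting at $(0,0)$, ending at $(n,0)$ and never going below the $x$-axis. Write $D=(1,-1)$, $F=(1,0)$, $U_i=(1,i)$ for $i\geq1$. Steps are numbered $1,\dots,n$; an occurrence of the pattern $DD$ (two consecutive $D$ steps) is at position $i$ if its first step is the $i$-th step. Two paths of the same length are $DD$-equivalent if the sets of occurrence positions of $DD$ in them are identical. *)

(* Defs.v *)
From mathcomp Require Import all_boot all_order all_algebra.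
From mathcomp Require Import boolp classical_sets functions cardinality.

Set Implicit Arguments.
Unset Strict Implicit.
Unset Printing Implicit Defensive.

Import Order.TTheory GRing.Theory Num.Theory.
Local Open Scope classical_set_scope.
Local Open Scope ring_scope.

(* A step (1, i) is represented by its vertical component i, and a path by the
   sequence of its steps; thus D is -1, F is 0 and U_i is i. *)
Definition lukasiewicz_path (n : nat) (P : seq int) : Prop :=
  [/\ size P = n,
      forall i : int, i \in P -> -1 <= i,
      forall k : nat, (k <= n)%N -> 0 <= \sum_(i <- take k P) i
    & \sum_(i <- P) i = 0].

Definition lukasiewicz_paths (n : nat) : set (seq int) :=
  [set P | lukasiewicz_path n P].

(* Steps are numbered from 1, so the i-th step is the entry of index i - 1. *)
Definition DD_positions (P : seq int) : set nat :=
  [set i : nat | [/\ (0 < i)%N, (i < size P)%N,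
                     nth 0 P i.-1 = -1 & nth 0 P i = -1]].

Definition DD_equivalent (P Q : seq int) : Prop :=
  size P = size Q /\ DD_positions P = DD_positions Q.

Definition equivalence_classes (T : Type) (R : T -> T -> Prop) (A : set T) :
    set (set T) :=
  [set [set y | A y /\ R x y] | x in A].

Fixpoint g (n : nat) : nat :=
  match n with
  | 0 | 1 | 2 => 1
  | 3 => 2
  | ((((n4.+1) as n3).+1 as n2).+1 as n1).+1 => g n1 + g n2 + g n4
  end%N.

(* Main.v *)
(* A set S of positions is the set of DD-occurrences of some path of length n iff
   S lies in {2, ..., n - 1} and its indicator word avoids 101: position 1 would
   need an initial D, and two occurrences at i and i + 2 force one at i + 1.
   Conversely, make every step in S or S + 1 a D, every other step an F, and let
   the first step be the U_k that balances the D's.  So the classes are counted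
   by the binary words of length n - 2 that avoid 101. *)
Require Import Defs.
From mathcomp Require Import all_boot all_order all_algebra.
From mathcomp Require Import boolp classical_sets functions cardinality.
From mathcomp Require Import zify.

Set Implicit Arguments.
Unset Strict Implicit.
Unset Printing Implicit Defensive.

Import Order.TTheory GRing.Theory Num.Theory.

Local Open Scope classical_set_scope.
Local Open Scope card_scope.

Fixpoint words (m : nat) : seq (seq bool) :=
  if m is m'.+1 then
    [seq false :: w | w <- words m'] ++ [seq true :: w | w <- words m']
  else [:: [::]].

Lemma mem_words m w : (w \in words m) = (size w == m).
Proof.
have consI (b : bool) : injective (cons b) by move=> ? ? [].
elim: m w => [|m IHm] [|b w] //=; rewrite mem_cat.
  by apply/orP => -[] /mapP[].
have notin c d s : c != d -> (c :: w \in [seq d :: v | v <- s]) = false.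
  by move=> /eqP ncd; apply/mapP => -[v _ [/ncd]].
case: b; rewrite ?(notin true false) ?(notin false true) //= ?orbF.
  by rewrite (mem_map (consI true)) IHm.
by rewrite (mem_map (consI false)) IHm.
Qed.

Lemma uniq_words m : uniq (words m).
Proof.
have consI (b : bool) : injective (cons b) by move=> ? ? [].
elim: m => [|m IHm] //=; rewrite cat_uniq !map_inj_uniq // IHm /= andbT.
by apply/hasPn => _ /mapP[w _ ->]; apply/mapP => -[].
Qed.

Definition avoids101 (w : seq bool) := ~~ infix [:: true; false; true] w.

Lemma avoids101P (w : seq bool) :
  reflect (forall i, nth false w i -> nth false w i.+2 -> nth false w i.+1)
          (avoids101 w).
Proof.
apply: (iffP negP) => [H i h0 h2 | H].
  apply/negP => /negP h1; apply: H; elim: w i h0 h1 h2 => [|b w IHw] [|i] //=.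
    case: b => // _; case: w {IHw} => [|[] [|c w]] //= _ ->.
    by rewrite eqxx prefix0s.
  by move=> h0 h1 h2; rewrite (IHw i h0 h1 h2) orbT.
case/infixP=> s [t Es].
have nthE k : nth false w (size s + k) = nth false [:: true, false, true & t] k.
  by rewrite Es nth_cat ltnNge leq_addr /= addKn.
have := H (size s); rewrite -[size s]addn0 -!addnS !nthE /=.
by move=> /(_ isT isT).
Qed.

(** Splitting on the first letter gives a linear system for [a] and [b], where [b] records that a
    [true] has just been read. *)
Lemma count_avoids101 m : count avoids101 (words m) = g m.+2.
Proof.
pose a k := count avoids101 (words k).
pose b k := count (fun w => avoids101 (true :: w)) (words k).
have wordsS k : words k.+1 =
    [seq false :: w | w <- words k] ++ [seq true :: w | w <- words k] by [].
have aS k : a k.+1 = a k + b k.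
  rewrite /a /b wordsS count_cat !count_map.
  by congr addn; apply: eq_count => w /=; rewrite /avoids101 /=.
(* After the leading [true], another [true] makes the first one irrelevant; a [false] must be
   followed by a second [false], and then the last [k] letters only have to avoid 101. *)
have bS k : b k.+2 = b k.+1 + a k.
  rewrite {1}/b wordsS count_cat !count_map addnC; congr addn.
  rewrite wordsS count_cat !count_map.
  rewrite (@eq_count _ _ avoids101) => [|w]; last by rewrite /avoids101 /=.
  rewrite (@eq_count _ (preim _ _) pred0) ?count_pred0 ?addn0 //.
  by move=> w; rewrite /avoids101 /= prefix0s.
have gS k : g k.+4 = g k.+3 + g k.+2 + g k by [].
(* Eliminating [b] gives [a k.+3 + a k.+1 = 2 * a k.+2 + a k]. The sum of two consecutive instances
   is the recurrence of [g], which has order four, so the induction carries four values. *)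
suff : [/\ a m = g m.+2, a m.+1 = g m.+3, a m.+2 = g m.+4 & a m.+3 = g m.+4.+1].
  by case.
elim: m => [|m [e0 e1 e2 e3]]; first by [].
split=> //; have := aS m.+3; have := aS m.+2; have := bS m.+1.
have := aS m.+1; have := aS m; have := bS m.
have := gS m.+2; have := gS m.+1; have := gS m; lia.
Qed.

Local Open Scope ring_scope.

Lemma lukasiewicz_DD_gt1 n P i :
  lukasiewicz_path n P -> DD_positions P i -> (1 < i < n)%N.
Proof.
case=> <- _ P_ge0 _ [i_gt0 ltiP Di _]; rewrite ltiP andbT.
case: i i_gt0 ltiP Di => [|[|i]] // _ ltP D0.
have := P_ge0 1%N (ltnW ltP).
by case: P D0 {P_ge0} ltP => [|x P] //= -> _; rewrite take0 big_seq1.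
Qed.

Lemma DD_positions_convex P i :
  DD_positions P i -> DD_positions P i.+2 -> DD_positions P i.+1.
Proof. by move=> [_ _ _ Di] [_ lt2 D1 _]; split=> //; apply: ltnW. Qed.

(** Since the total is 0, the height after a nonempty prefix is minus the sum of the steps still to
    come, all of which are D or F. *)
Lemma lukasiewicz_cons (t : seq int) :
  (forall x, x \in t -> -1 <= x <= 0) ->
  lukasiewicz_path (size t).+1 (- (\sum_(x <- t) x) :: t).
Proof.
move=> t_bnd.
have le0 (s : seq int) : {subset s <= t} -> \sum_(x <- s) x <= 0.
  by move=> st; rewrite big_seq; apply: sumr_le0 => x /st /t_bnd /andP[].
split=> //.
- move=> x; rewrite inE => /orP[/eqP-> | /t_bnd/andP[] //].
  by have := le0 t (fun _ h => h); lia.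
- case=> [|k] _; first by rewrite big_nil.
  rewrite /= big_cons -{1}(cat_take_drop k t) big_cat /=.
  rewrite opprD addrAC addNr add0r oppr_ge0.
  by apply: le0 => x; exact: mem_drop.
- by rewrite big_cons addNr.
Qed.

Lemma lukasiewicz_DD_exists n (u : pred nat) :
    (forall i, u i -> (1 < i < n)%N) ->
    (forall i, u i -> u i.+2 -> u i.+1) ->
  exists2 P, lukasiewicz_path n P & DD_positions P = [set i | u i].
Proof.
case: n => [|n] u_bnd u101.
  exists [::]; first by split=> // [k _|]; rewrite ?take_nil big_nil.
  by apply/seteqP; split=> i /= => [[]|/u_bnd]; rewrite ?andbF.
(* The entry of index [j] is step [j.+1], a D when an occurrence is wanted at [j.+1] or at [j]. The
   list [t] lacks the first step, hence [d j.+1] below. *)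
pose d j := u j || u j.+1.
pose t : seq int := mkseq (fun j => if d j.+1 then -1 else 0) n.
have t_bnd x : x \in t -> -1 <= x <= 0.
  by case/mapP=> j _ ->; case: ifP.
have /= := lukasiewicz_cons t_bnd; rewrite size_mkseq => tP.
exists (- (\sum_(x <- t) x) :: t) => //.
have tD j : (j < n)%N -> (nth 0 t j = -1) <-> d j.+1.
  by move=> ltjn; rewrite nth_mkseq //; case: (d _).
apply/seteqP; split=> i.
(* No occurrence can start at the first step, so its value need not be examined. *)
- move=> Di; have := lukasiewicz_DD_gt1 tP Di; case: Di.
  case: i => [|[|i]] //= _ _ Di Di1; rewrite ltnS => lti.
  move/(tD _ (ltnW lti)): Di; move/(tD _ lti): Di1.
  (* If the two D's do not come from [i.+2] itself, they come from [i.+1] and [i.+3], which force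
     [i.+2]. *)
  rewrite /d => /orP[//|u3] /orP[u1|//]; exact: u101.
- move=> /= ui; have := u_bnd i ui; case: i ui => [|[|i]] // ui.
  move=> /andP[_]; rewrite ltnS => lti; split=> //=.
  + by rewrite ltnS size_mkseq.
  + by apply/(tD _ (ltnW lti)); rewrite /d ui orbT.
  + by apply/(tD _ lti); rewrite /d ui.
Qed.

(** The two leading letters [false] shift the word so that its first letter stands for position 2,
    the least possible one. *)
Definition word_positions (w : seq bool) : set nat :=
  [set i | nth false [:: false, false & w] i].

Lemma word_positions_inj v w :
  size v = size w -> word_positions v = word_positions w -> v = w.
Proof.
move=> eqs eqvw; apply: (@eq_from_nth _ false) => // i _.
have /= := congr1 (fun A : set nat => A i.+2) eqvw.
by rewrite /word_positions /= => e; apply/idP/idP; rewrite e.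
Qed.

Lemma word_positions_realizable n w :
    size w = (n - 2)%N -> avoids101 w ->
  exists2 P, lukasiewicz_path n P & DD_positions P = word_positions w.
Proof.
move=> szw /avoids101P w101; apply: lukasiewicz_DD_exists => [[|[|i]]|[|[|i]]] //=.
- move=> wi; suff : (i < size w)%N by rewrite szw; lia.
  by rewrite ltnNge; apply/negP => /(nth_default false) w0; rewrite w0 in wi.
- exact: w101.
Qed.

Lemma DD_positions_word n P : lukasiewicz_path n P ->
  exists w, [/\ size w = (n - 2)%N, avoids101 w
              & DD_positions P = word_positions w].
Proof.
move=> nP; pose w := mkseq (fun i => `[< DD_positions P i.+2 >]) (n - 2).
have wE i : nth false w i <-> DD_positions P i.+2.
  have [lti|lein] := ltnP i (n - 2).
    by rewrite nth_mkseq //; split=> /asboolP.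
  (* Past the end of the word the default letter is [false], and no occurrence starts at [n] or
     later. *)
  rewrite nth_default ?size_mkseq //; split=> // /(lukasiewicz_DD_gt1 nP).
  by lia.
exists w; split; first by rewrite size_mkseq.
- apply/avoids101P => i /wE Di /wE Di2; apply/wE.
  exact: DD_positions_convex Di2.
- apply/seteqP; split=> [i Di|]; last by case=> [|[|i]] // /wE.
  have := lukasiewicz_DD_gt1 nP Di.
  by case: i Di => [|[|i]] // Di _; apply/wE.
Qed.

Theorem theorem5 (n : nat) :
  equivalence_classes DD_equivalent (lukasiewicz_paths n) #= `I_(g n).
Proof.
pose s := filter avoids101 (words (n - 2)).
have sP w : reflect (size w = (n - 2)%N /\ avoids101 w) (w \in s).
  rewrite mem_filter mem_words.
  by apply: (iffP andP) => [[aw /eqP szw] | [/eqP szw aw]].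
have <- : size s = g n.
  rewrite size_filter count_avoids101.
  (* For [n < 2] the truncated [n - 2] is 0, and the empty word alone gives the value 1. *)
  by case: n {s sP} => [|[|n]] //; rewrite subn2.
pose F i := [set Q | lukasiewicz_path n Q
                   /\ word_positions (nth [::] s i) = DD_positions Q].
have -> : equivalence_classes DD_equivalent (lukasiewicz_paths n)
        = F @` `I_(size s).
  have classE P w : lukasiewicz_path n P -> DD_positions P = word_positions w ->
      [set Q | lukasiewicz_paths n Q /\ DD_equivalent P Q]
      = [set Q | lukasiewicz_path n Q /\ word_positions w = DD_positions Q].
    move=> nP eP; apply/seteqP; rewrite -eP; split=> Q /= [nQ].
      by case.
    by move=> ePQ; split=> //; split=> //; case: nP nQ => -> _ _ _ [->].
  apply/seteqP; split=> [_ [P nP <-]|_ [i lti <-]].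
    have [w [szw aw eP]] := DD_positions_word nP.
    have ws : w \in s by apply/sP.
    exists (index w s); first by rewrite /= index_mem.
    by rewrite /F nth_index // -(classE P).
  have /sP[szw aw] := mem_nth [::] lti.
  have [P nP eP] := word_positions_realizable szw aw.
  by exists P => //; apply: classE.
apply: inj_card_eq => i j; rewrite !inE => lti ltj eF.
have /sP[szi ai] := mem_nth [::] lti; have /sP[szj _] := mem_nth [::] ltj.
(* Each class is nonempty, and any path in it determines the word. *)
have [P nP eP] := word_positions_realizable szi ai.
have : F i P by split.
rewrite eF => -[_]; rewrite eP => eij.
apply/eqP; rewrite -(nth_uniq [::] lti ltj) ?filter_uniq ?uniq_words //.
by apply/eqP/word_positions_inj; rewrite ?szi.
Qed.
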